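(* Let $\mathcal{G}=\langle V,E,w\rangle$ be a bidding mean-payoff game and $v\in V$. If Min's initial budget exceeds $\textsc{Thresh}(v)$, then Min has a memoryless strategy from $v$ that guarantees a non-positive mean-payoff value.
   Context: A bidding game is played on a finite directed graph $(V,E)$ (every vertex having an outgoing edge) by moving a token. The players, Min and Max, hold budgets summing to $1$. In each round both simultaneously submit a bid, a real number between $0$ and their current budget; the higher bidder pays his bid to the other player and moves the token along an outgoing edge; ties are resolved by some fixed tie-breaking rule. A strategy maps each finite history (visited vertices together with winning bids and winners) to a legal bid and a successor to move to upon winning. In a bidding mean-payoff game $\langle V,E,w\rangle$, $w:V\to\mathbb{Z}$; for an infinite play $\pi=v_0v_1\ldots$ the energy of the length-$n$ prefix is $E(\pi^n)=\sum_{i=0}^{n-1}w(v_i)$ and the mean-payoff value is $\liminf_{n\to\infty}E(\pi^n)/n$. The threshold budget $\textsc{Thresh}:V\to[0,1]$ is such that if Min's budget at $v$ exceeds $\textsc{Thresh}(v)$ then Min can guarantee a non-positive mean-payoff value, and if Max's budget exceeds $1-\textsc{Thresh}(v)$ then Max can guarantee a strictly positive mean-payoff value. A memoryless strategy at a vertex $v$ with initial budget $B$ is a pair $\langle u,f^B_v\rangle$ where $u$ is a successor of $v$ (the vertex moved to upon winning) and $f^B_v$ maps the current budget and the current energy to a bid, where $f^B_v$ is required to be simple, namely a polynomial or a selection among a constant number of polynomials; a memoryless strategy may depend on the initial vertex and initial budget, and a concatenation of memoryless strategies is also called memoryless. *)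

(* Defs.v *)
From HB Require Import structures.
From mathcomp Require Import all_boot all_order all_algebra.
From mathcomp Require Import polyXY.
From mathcomp Require Import all_classical all_reals all_analysis.
Set Implicit Arguments.
Unset Strict Implicit.
Unset Printing Implicit Defensive.
Import Order.TTheory GRing.Theory Num.Theory.
Local Open Scope ring_scope.

Record mp_game := MPGame {
  vertex : finType;
  edge : rel vertex;
  weight : vertex -> int;
  edge_total : forall v : vertex, exists u : vertex, edge v u }.

Inductive player := Min | Max.

(* [hround h p b u]: after [h], player [p] won the bidding with bid [b] (paid
   to the opponent) and moved the token to [u]. *)
Inductive history (R : realType) (G : mp_game) :=
| hstart of vertex G
| hround of history R G & player & R & vertex G.
Arguments hstart R {G} v.

Definition cur (R : realType) (G : mp_game) (h : history R G) : vertex G :=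
  match h with hstart v => v | hround _ _ _ u => u end.

(* Min's budget after [h], when it is [B] initially; Max holds the rest of the
   total budget 1. *)
Fixpoint min_budget (R : realType) (G : mp_game) (B : R) (h : history R G) : R :=
  match h with
  | hstart _ => B
  | hround h' Min b _ => min_budget B h' - b
  | hround h' Max b _ => min_budget B h' + b
  end.

Definition budget (R : realType) (G : mp_game) (p : player) (B : R)
    (h : history R G) : R :=
  match p with Min => min_budget B h | Max => 1 - min_budget B h end.

Fixpoint valid_history (R : realType) (G : mp_game) (v : vertex G) (B : R)
    (h : history R G) : Prop :=
  match h with
  | hstart v' => v' = v
  | hround h' p b u =>
      [/\ valid_history v B h', 0 <= b <= budget p B h' & edge (cur h') u]
  end.

(* The bid, and the vertex to move to upon winning. *)
Definition strategy (R : realType) (G : mp_game) := history R G -> R * vertex G.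

(* [B] is Min's initial budget, also when [p] is Max. *)
Definition legal (R : realType) (G : mp_game) (p : player) (v : vertex G) (B : R)
    (s : strategy R G) : Prop :=
  forall h : history R G, valid_history v B h ->
    0 <= (s h).1 <= budget p B h /\ edge (cur h) (s h).2.

(* Who wins a tie, given the history and the common bid. *)
Definition tie_rule (R : realType) (G : mp_game) := history R G -> R -> player.

Fixpoint play_prefix (R : realType) (G : mp_game) (tie : tie_rule R G)
    (smin smax : strategy R G) (v : vertex G) (n : nat) : history R G :=
  match n with
  | 0%N => hstart R v
  | n'.+1 =>
      let h := play_prefix tie smin smax v n' in
      let min_wins := hround h Min (smin h).1 (smin h).2 in
      let max_wins := hround h Max (smax h).1 (smax h).2 in
      if (smax h).1 < (smin h).1 then min_wins
      else if (smin h).1 < (smax h).1 then max_wins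
      else match tie h (smin h).1 with Min => min_wins | Max => max_wins end
  end.

Definition play (R : realType) (G : mp_game) (tie : tie_rule R G)
    (smin smax : strategy R G) (v : vertex G) : nat -> vertex G :=
  fun n => cur (play_prefix tie smin smax v n).

Definition energy (G : mp_game) (path : nat -> vertex G) (n : nat) : int :=
  \sum_(i < n) weight (path i).

(* At [n = 0] the quotient is the junk value 0, which does not affect the
   limit inferior. *)
Definition mean_payoff (R : realType) (G : mp_game) (path : nat -> vertex G) :
    \bar R :=
  limn_einf (fun n => ((energy path n)%:~R / n%:R : R)%:E).

Definition min_guarantees (R : realType) (G : mp_game) (tie : tie_rule R G)
    (v : vertex G) (B : R) (smin : strategy R G) : Prop :=
  legal Min v B smin /\
  forall smax : strategy R G, legal Max v B smax ->
    (mean_payoff R (play tie smin smax v) <= 0)%E.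

Definition max_guarantees (R : realType) (G : mp_game) (tie : tie_rule R G)
    (v : vertex G) (B : R) (smax : strategy R G) : Prop :=
  legal Max v B smax /\
  forall smin : strategy R G, legal Min v B smin ->
    (0 < mean_payoff R (play tie smin smax v))%E.

(* [B] is Min's budget and [C] is Max's. *)
Definition is_threshold (R : realType) (G : mp_game) (tie : tie_rule R G)
    (Thresh : vertex G -> R) : Prop :=
  forall v : vertex G,
  [/\ 0 <= Thresh v <= 1,
      forall B : R, 0 <= B <= 1 -> Thresh v < B ->
        exists smin : strategy R G, min_guarantees tie v B smin
    & forall C : R, 0 <= C <= 1 -> 1 - Thresh v < C ->
        exists smax : strategy R G, max_guarantees tie v (1 - C) smax].

(* What a memoryless strategy prescribes, for a fixed initial vertex and initial
   budget: at each vertex, the successor to move to and the bid as a function of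
   the current budget and the current energy. *)
Record memoryless (R : realType) (G : mp_game) := Memoryless {
  move_to : vertex G -> vertex G;
  bid : vertex G -> R -> int -> R }.

(* [f] is a selection among [m] polynomials in (budget, energy). *)
Definition selection_of_polys (R : realType) (m : nat) (f : R -> int -> R) : Prop :=
  exists p : 'I_m -> {poly {poly R}},
    forall (x : R) (k : int), exists i : 'I_m, f x k = (p i).[x, k%:~R].

(* A constituent of a concatenation. [plan v B] is the memoryless strategy used
   when the constituent is started at [v] with budget [B]. It is followed for
   at least one round, until the token is at a vertex [u], and [k] is the energy
   accumulated since it was started, with [stop u k]. *)
Record phase (R : realType) (G : mp_game) := Phase {
  plan : vertex G -> R -> memoryless R G;
  stop : vertex G -> int -> bool }.

Record phase_state (R : realType) (G : mp_game) := PhaseState {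
  index : nat;
  init_vertex : vertex G;
  init_budget : R;
  phase_energy : int }.

(* The state, after [h], of the concatenation of [c 0], [c 1], ...: each phase is
   started afresh (hence with energy 0) where the preceding one stopped. *)
Fixpoint run_phases (R : realType) (G : mp_game) (c : nat -> phase R G) (B : R)
    (h : history R G) : phase_state R G :=
  match h with
  | hstart v => PhaseState 0 v B 0
  | hround h' _ _ u =>
      let s := run_phases c B h' in
      let k := phase_energy s + weight (cur h') in
      if stop (c (index s)) u k
      then PhaseState (index s).+1 u (min_budget B h) 0
      else PhaseState (index s) (init_vertex s) (init_budget s) k
  end.

Definition concatenation (R : realType) (G : mp_game) (c : nat -> phase R G)
    (B : R) : strategy R G :=
  fun h =>
    let s := run_phases c B h in
    let sigma := plan (c (index s)) (init_vertex s) (init_budget s) in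
    (bid sigma (cur h) (min_budget B h) (phase_energy s), move_to sigma (cur h)).

(* Concatenations of finitely many memoryless strategies, in which the last one
   may be started anew each time it stops; taking [stop] constantly false in
   [c 0] gives a single memoryless strategy. The number of polynomials is
   bounded uniformly over all phases, vertices, initial vertices and budgets. *)
Definition memoryless_strategy (R : realType) (G : mp_game) (B : R)
    (smin : strategy R G) : Prop :=
  exists (c : nat -> phase R G) (last m : nat),
  [/\ forall i : nat, (last <= i)%N -> c i = c last,
      forall (i : nat) (v0 : vertex G) (B0 : R) (v : vertex G),
        edge v (move_to (plan (c i) v0 B0) v) /\
        selection_of_polys m (bid (plan (c i) v0 B0) v)
    & forall h : history R G, smin h = concatenation c B h].

(* Main.v *)
Require Import Defs.
From mathcomp Require Import all_boot all_order all_algebra.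
From mathcomp Require Import all_classical all_reals all_analysis.
From mathcomp Require Import ring lra.
Set Implicit Arguments.
Unset Strict Implicit.
Unset Printing Implicit Defensive.
Import Order.TTheory GRing.Theory Num.Theory.
Import numFieldNormedType.Exports.
Local Open Scope ring_scope.

(* For y : V -> R let L y be the least fixpoint in [0,1]^V of
   P |-> clamp (y + avg P), where avg P v is the mean of the largest and the
   smallest value of P at the successors of v.  Let T be a cluster point of
   L (w / n) as n tends to infinity; then T = avg T.

   If Min's budget exceeds T v by s, choose n with P = L (w / n) close to T and
   let Min bid (max P - min P) / 2, moving to a successor of least P.  Then
   budget >= P + s' + energy / n persists as long as the energy is nonnegative,
   so the energy is at most n; when it becomes negative the budget still exceeds
   T, and Min starts again with another n.  In both cases the mean payoff is
   nonpositive.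

   If Min's budget is below T v, Max wins, hence T <= Thresh.  By leastness,
   no closed set carries a constant value of T in (0,1); so T = L y for y = 2 on
   Z = {T = 1} and 0 elsewhere, and L is lower continuous in y, so that Max can
   afford to lose a fixed d > 0 in every round and still reach Z with a positive
   budget.  On Z the same continuity gives a potential with drift delta > 0;
   with bids proportional to Max's budget, the logarithm of this budget plus a
   multiple of the energy grows linearly. *)

(** * Extreme successors and their mean *)

Section Average.
Variables (R : realType) (G : mp_game).
Implicit Types (v u : vertex G) (f g P : vertex G -> R).

Definition amax f v : vertex G :=
  [arg max_(u > xchoose (edge_total v) | edge v u) f u]%O.

Definition amin f v : vertex G :=
  [arg min_(u < xchoose (edge_total v) | edge v u) f u]%O.

Lemma edge_amax f v : edge v (amax f v).
Proof. by rewrite /amax; case: arg_maxP => //; exact: (xchooseP (edge_total v)). Qed.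

Lemma edge_amin f v : edge v (amin f v).
Proof. by rewrite /amin; case: arg_minP => //; exact: (xchooseP (edge_total v)). Qed.

Lemma le_amax f v u : edge v u -> f u <= f (amax f v).
Proof.
rewrite /amax; case: arg_maxP; first exact: (xchooseP (edge_total v)).
by move=> w _ h /h.
Qed.

Lemma ge_amin f v u : edge v u -> f (amin f v) <= f u.
Proof.
rewrite /amin; case: arg_minP; first exact: (xchooseP (edge_total v)).
by move=> w _ h /h.
Qed.

Definition avg f v : R := (f (amax f v) + f (amin f v)) / 2.

(** The balanced bid: by [amaxE] and [aminE], paying it to reach one extreme, or receiving it while
    the opponent takes the other, shifts budget and [f] by the same amount. *)
Definition half_gap f v : R := (f (amax f v) - f (amin f v)) / 2.

Lemma half_gap_ge0 f v : 0 <= half_gap f v.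
Proof. by have := ge_amin f (edge_amax f v); rewrite /half_gap; lra. Qed.

Lemma half_gap_le_half f v :
  (forall w, 0 <= f w <= 1) -> half_gap f v <= 1 / 2.
Proof.
move=> f01; have := f01 (amin f v); have := f01 (amax f v).
by rewrite /half_gap; lra.
Qed.

Lemma amaxE f v : f (amax f v) = avg f v + half_gap f v.
Proof. by rewrite /avg /half_gap; lra. Qed.

Lemma aminE f v : f (amin f v) = avg f v - half_gap f v.
Proof. by rewrite /avg /half_gap; lra. Qed.

Lemma le_avgD f g v c :
  (forall u, edge v u -> g u <= f u + c) -> avg g v <= avg f v + c.
Proof.
move=> h; have := h _ (edge_amax g v); have := h _ (edge_amin f v).
have := le_amax f (edge_amax g v); have := ge_amin g (edge_amin f v).
by rewrite /avg; lra.
Qed.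

Lemma le_avg f g v : (forall u, edge v u -> g u <= f u) -> avg g v <= avg f v.
Proof. by move=> h; rewrite -[leRHS]addr0; apply: le_avgD => u /h; rewrite addr0. Qed.

Lemma avg_amaxE f v : avg f v = f (amax f v) -> forall u, edge v u -> f u = f (amax f v).
Proof.
move=> e u vu; apply/eqP; rewrite eq_le le_amax //=.
by have := ge_amin f vu; move: e; rewrite /avg; lra.
Qed.

End Average.

(** * Least fixpoints of the clamped averaging operator *)

Section LeastFixpoint.
Variables (R : realType) (G : mp_game).
Implicit Types (v u : vertex G) (f g P y : vertex G -> R).

Definition clamp (x : R) : R := if x <= 0 then 0 else if 1 <= x then 1 else x.

Ltac clamp_lra := rewrite /clamp; repeat case: ifP; lra.

Lemma clamp_ge0 x : 0 <= clamp x. Proof. by clamp_lra. Qed.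

Lemma clamp_le1 x : clamp x <= 1. Proof. by clamp_lra. Qed.

Lemma le_clampD x z c : 0 <= c -> x <= z + c -> clamp x <= clamp z + c.
Proof. by clamp_lra. Qed.

Lemma le_clamp x z : x <= z -> clamp x <= clamp z.
Proof. by clamp_lra. Qed.

Lemma clamp_le x z : 0 <= z -> x <= z -> clamp x <= z.
Proof. by clamp_lra. Qed.

Lemma clamp_id x : 0 <= x <= 1 -> clamp x = x.
Proof. by clamp_lra. Qed.

(** Only the cut at 0 raises a number and only the cut at 1 lowers it; hence the one-sided bounds
    here and in [clamp_lt1]. *)
Lemma clamp_gt0 x : 0 < clamp x -> clamp x <= x.
Proof. by clamp_lra. Qed.

Lemma clamp_lt1 x : clamp x < 1 -> x <= clamp x.
Proof. by clamp_lra. Qed.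

Definition prefixpoint y P :=
  forall v, 0 <= P v /\ clamp (y v + avg P v) <= P v.

Definition lfp y v : R := inf [set P v | P in prefixpoint y]%classic.

Lemma lfp_has_inf y v : has_inf [set P v | P in prefixpoint y]%classic.
Proof.
split; last by exists 0 => _ [P Pp <-]; case: (Pp v).
exists 1, (fun=> 1) => // u; split; first lra.
exact: clamp_le1.
Qed.

Lemma lfp_least y P v : prefixpoint y P -> lfp y v <= P v.
Proof. by move=> Pp; apply: ge_inf; [case: (lfp_has_inf y v) | exists P]. Qed.

Lemma lfp_glb y v c : (forall P, prefixpoint y P -> c <= P v) -> c <= lfp y v.
Proof.
move=> h; apply: lb_le_inf; first by case: (lfp_has_inf y v).
by move=> _ [P Pp <-]; exact: h.
Qed.

Lemma lfp_ge0 y v : 0 <= lfp y v.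
Proof. by apply: lfp_glb => P /(_ v)[]. Qed.

Lemma lfp_prefixpoint y : prefixpoint y (lfp y).
Proof.
move=> v; split; first exact: lfp_ge0.
apply: lfp_glb => P Pp; apply: le_trans (proj2 (Pp v)).
by apply: le_clamp; rewrite lerD2l; apply: le_avg => u _; exact: lfp_least.
Qed.

Lemma lfpE y v : lfp y v = clamp (y v + avg (lfp y) v).
Proof.
apply/eqP; rewrite eq_le (proj2 (lfp_prefixpoint y v)) andbT.
apply: (@lfp_least y (fun u => clamp (y u + avg (lfp y) u))) => u.
split; first exact: clamp_ge0.
apply: le_clamp; rewrite lerD2l; apply: le_avg => w _.
exact: (proj2 (lfp_prefixpoint y w)).
Qed.

Lemma lfp_le1 y v : lfp y v <= 1.
Proof. by rewrite lfpE clamp_le1. Qed.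

Lemma lfp01 y v : 0 <= lfp y v <= 1.
Proof. by rewrite lfp_ge0 lfp_le1. Qed.

Lemma le_lfp y z v : (forall u, y u <= z u) -> lfp y v <= lfp z v.
Proof.
move=> yz; apply: lfp_least => u; split; first exact: lfp_ge0.
by apply: le_trans (proj2 (lfp_prefixpoint z u)); apply: le_clamp; rewrite lerD2r.
Qed.

(* [clamp (y v + avg P v)] is 1-Lipschitz in [y] and [P], so the supremum of the least
   fixpoints for [y - d], [d > 0], is a prefixpoint for [y]. *)
Lemma lfp_lower_continuous y e : 0 < e ->
  exists2 d, 0 < d <= 1 & forall v, lfp y v - e <= lfp (fun u => y u - d) v.
Proof.
move=> e0; pose A v := [set lfp (fun u => y u - d) v | d in [set d | 0 < d <= 1]]%classic.
have supA v : has_sup (A v).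
  split; first by exists (lfp (fun u => y u - 1) v), 1 => //=; lra.
  by exists 1 => _ [d _ <-]; exact: lfp_le1.
pose S v := sup (A v).
have leS d v : 0 < d <= 1 -> lfp (fun u => y u - d) v <= S v.
  by move=> d1; apply: ub_le_sup; [case: (supA v) | exists d].
have approx c : 0 < c -> exists2 d, 0 < d <= 1 /\ d <= c &
    forall v, S v - c <= lfp (fun u => y u - d) v.
  move=> c0.
  have /choice[dv dvP] v : exists d, 0 < d <= 1 /\ S v - c < lfp (fun u => y u - d) v.
    by have [_ [d d1 <-] h] := sup_adherent c0 (supA v); exists d.
  (* A smaller shift only raises [lfp], so the least of the finitely many [dv v] serves every
     vertex. *)
  pose d := \big[Num.min/Num.min 1 c]_v dv v.
  have dle v : d <= dv v by exact: bigmin_le_cond.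
  have dc : d <= Num.min 1 c by exact: bigmin_le_id.
  have d0 : 0 < d.
    apply/bigmin_gtP; split => [|v _]; first by rewrite lt_min c0 ltr01.
    by case: (dvP v) => /andP[].
  move: dc; rewrite le_min => /andP[d1 dc].
  exists d => [|v]; first by rewrite d0 d1.
  case: (dvP v) => _ /ltW /le_trans; apply; apply: le_lfp => u.
  by rewrite lerB.
have Sp : prefixpoint y S.
  move=> v; split.
    by apply: le_trans (leS 1 v _); [exact: lfp_ge0 | lra].
  (* Half of [c] pays for the shift [d], half for replacing [S] by the shifted fixpoint. *)
  apply/ler_addgt0Pr => c c0; have c20 : 0 < c / 2 by lra.
  have [d [d1 dc] h] := approx _ c20.
  apply: le_trans (lerD (leS d v d1) (lexx c)); rewrite lfpE.
  apply: le_clampD; first lra.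
  suff : avg S v <= avg (lfp (fun u => y u - d)) v + c / 2 by lra.
  by apply: le_avgD => u _; have := h u; lra.
have [d [d1 _] h] := approx _ e0; exists d => // v.
by apply: le_trans (h v); rewrite lerB // lfp_least.
Qed.

(** Otherwise lower [lfp y] on [S] by its minimum there. As no edge leaves [S], the averages on [S]
    drop equally, and values below 1 are not cut from above; so a smaller prefixpoint results. *)
Lemma lfp_no_closed_interior y (S : pred (vertex G)) v :
  S v -> (forall u w, S u -> edge u w -> S w) ->
  exists2 u, S u & ~~ (0 < lfp y u < 1).
Proof.
move=> Sv Scl; apply/not_exists2P => H.
have {H}H u : S u -> 0 < lfp y u < 1.
  by case: (H u) => // + Su => /negP; rewrite negbK.
pose P := lfp y; pose e := \big[Num.min/1]_(u | S u) P u.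
have e0 : 0 < e by apply/bigmin_gtP; split => // u /H /andP[].
have eP u : S u -> e <= P u by move=> Su; exact: bigmin_le_cond.
suff /lfp_least -/(_ v) : prefixpoint y (fun u => if S u then P u - e else P u).
  by rewrite Sv /P; lra.
move=> u; case: ifP => Su; last first.
  split; first exact: lfp_ge0.
  rewrite [leRHS](lfpE y u); apply: le_clamp; rewrite lerD2l.
  by apply: le_avg => w _; case: ifP => _; rewrite /P; lra.
have /andP[Pu0 Pu1] := H u Su; have eu := eP u Su.
split; first lra.
apply: clamp_le; first lra.
have : avg (fun u => if S u then P u - e else P u) u <= avg P u - e.
  by apply: le_avgD => w uw; rewrite (Scl _ _ Su uw); lra.
have := @clamp_lt1 (y u + avg P u); rewrite -lfpE => /(_ Pu1).
by rewrite /P; lra.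
Qed.

End LeastFixpoint.

Lemma eventually_le_mulrn (R : realType) (e K : R) : 0 < e ->
  exists N, forall n, (N <= n)%N -> K <= e * n%:R.
Proof.
move=> e0; exists (Num.truncn (`|K| / e)).+1 => n Nn.
apply: le_trans (ler_norm _) _; rewrite mulrC -ler_pdivrMr // ltW //.
have K0 : 0 <= `|K| / e by apply: divr_ge0 => //; exact: ltW.
by have /andP[_ /lt_le_trans] := truncn_itv K0; apply; rewrite ler_nat.
Qed.

(** * The limit of the values under vanishing weights *)

Section Limit.
Variables (R : realType) (G : mp_game).
Implicit Types (v u : vertex G) (T : vertex G -> R).

Definition scale_by n (k : int) : R := k%:~R / n.+1%:R.

Lemma scale_byD n k l : scale_by n (k + l) = scale_by n k + scale_by n l.
Proof. by rewrite /scale_by intrD mulrDl. Qed.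

Definition scaled_weight n v : R := scale_by n (weight v).

Definition value n : vertex G -> R := lfp (scaled_weight n).

(* [value n] need not converge; a cluster point is enough. *)
Definition limit_value T := (forall v, 0 <= T v <= 1) /\
  forall e : R, 0 < e ->
    exists n, forall v, `|value n v - T v| <= e /\ `|scaled_weight n v| <= e.

Lemma cluster_unit_cube (I : finType) (f : nat -> I -> R) :
  (forall n i, 0 <= f n i <= 1) ->
  exists T : I -> R, (forall i, 0 <= T i <= 1) /\
    forall (e : R) N, 0 < e -> exists2 n, (N <= n)%N & forall i, `|f n i - T i| <= e.
Proof.
move=> f01.
have /= cpt := @tychonoff I (fun=> R) (fun=> `[0, 1]%classic)
  (fun=> @segment_compact R 0 1).
have [|T [T01 clT]] := cpt (f @ \oo)%classic _.
  by exists 0%N => //= n _ i; rewrite in_itv /=.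
exists T; split=> [i|e N e0]; first by have /= := T01 i; rewrite in_itv.
pose B := [set g : I -> R | forall i, `|g i - T i| <= e]%classic.
(* Finiteness of [I] makes [B] a finite intersection of preimages under projections. *)
have nB : nbhs (T : prod_topology (fun _ : I => R)) B.
  apply: (@filter_forall _ I (fun i => [set g : prod_topology (fun _ : I => R) |
    `|g i - T i| <= e]%classic) _ (nbhs_filter _)) => i.
  have h := @proj_continuous I (fun=> R) i T.
  have := h [set x | `|x - T i| <= e]%classic; apply.
  apply/nbhs_ballP; exists e => //= x; rewrite /ball /= distrC => /ltW //.
have [|g [[n /= Nn <-] Bg]] := clT [set f n | n in [set n | (N <= n)%N]]%classic B _ nB.
  by exists N => // n /= Nn; exists n.
by exists n.
Qed.

Lemma limit_value_exists : exists T, limit_value T.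
Proof.
have [|T [T01 clT]] := @cluster_unit_cube _ value.
  by move=> n v; rewrite lfp_ge0 lfp_le1.
exists T; split=> // e e0.
pose W : R := \sum_(v : vertex G) `|(weight v)%:~R|.
have [N We] := eventually_le_mulrn W e0.
have [n Nn h] := clT e N e0.
exists n => v; split=> //.
rewrite /scaled_weight /scale_by normrM normfV normr_nat ler_pdivrMr ?ltr0n //.
apply: le_trans (We n.+1 (leqW Nn)).
by rewrite /W (bigD1 v) //= lerDl sumr_ge0.
Qed.

Variable T : vertex G -> R.
Hypothesis T_lim : limit_value T.

Lemma limit_ge0 v : 0 <= T v. Proof. by case: T_lim => /(_ v)/andP[]. Qed.

Lemma limit_le1 v : T v <= 1. Proof. by case: T_lim => /(_ v)/andP[]. Qed.

Definition close e n := forall v,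
  [/\ T v - e <= value n v, value n v <= T v + e,
      - e <= scaled_weight n v & scaled_weight n v <= e].

Lemma limit_approx e : 0 < e -> exists n, close e n.
Proof.
move=> e0; case: T_lim => _ /(_ e e0)[n h]; exists n => v.
by case: (h v); rewrite !ler_norml => /andP[? ?] /andP[? ?]; split; lra.
Qed.

Lemma limit_avg v : T v = avg T v.
Proof.
have T0 := limit_ge0; have T1 := limit_le1.
have av01 : 0 <= avg T v <= 1.
  have := T0 (amax T v); have := T0 (amin T v).
  have := T1 (amax T v); have := T1 (amin T v).
  by rewrite /avg; lra.
apply/eqP; rewrite eq_le; apply/andP; split; apply/ler_addgt0Pr => e e0;
  (* One third each for [value n] at [v], for the scaled weight and for the average. *)
  have e30 : 0 < e / 3 by lra.
all: have [n h] := limit_approx e30.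
all: have [h1 h2 h3 h4] := h v; have e1 : value n v = _ := lfpE _ v.
  have : clamp (scaled_weight n v + avg (value n) v) <= clamp (avg T v) + (e / 3 + e / 3).
    apply: le_clampD; first lra.
    have : avg (value n) v <= avg T v + e / 3.
      by apply: le_avgD => u _; have [] := h u; lra.
    by lra.
  by rewrite -[clamp (_ + _)]e1 clamp_id //; lra.
have : clamp (avg T v) <= clamp (scaled_weight n v + avg (value n) v) + (e / 3 + e / 3).
  apply: le_clampD; first lra.
  have : avg T v <= avg (value n) v + e / 3.
    by apply: le_avgD => u _; have [] := h u; lra.
  by lra.
by rewrite -[clamp (_ + _)]e1 clamp_id //; lra.
Qed.

Lemma limit_top_closed v u : T v = 1 -> edge v u -> T u = 1.
Proof.
move=> Tv vu; have := limit_avg v; have := limit_le1 (amax T v).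
have := limit_le1 u; have := ge_amin T vu.
by rewrite Tv /avg; lra.
Qed.

Lemma limit_closed_const (S : pred (vertex G)) c v :
  S v -> (forall u, S u -> T u = c) -> (forall u w, S u -> edge u w -> S w) ->
  ~~ (0 < c < 1).
Proof.
move=> Sv Tc Scl; apply/negP => c01.
have e0 : 0 < Num.min c (1 - c) / 2.
  by rewrite divr_gt0 // lt_min; lra.
have [n h] := limit_approx e0.
have [u Su /negP[]] := @lfp_no_closed_interior R G (scaled_weight n) S v Sv Scl.
have [] := h u; rewrite (Tc u Su) -/(value n u).
by case: (leP c (1 - c)) => ?; lra.
Qed.

Definition reach_reward v : R := if T v == 1 then 2 else 0.

(* On the set where [T - lfp reach_reward] is maximal, the vertices of largest
   [T] would form a closed set on which [T] is constant. *)
Lemma limit_reach : T =1 lfp reach_reward.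
Proof.
pose Q := lfp reach_reward; rewrite -/Q => v0.
have QT v : Q v <= T v.
  apply: lfp_least => u; split; first exact: limit_ge0.
  rewrite /reach_reward; case: eqP => [->|_]; first exact: clamp_le1.
  by rewrite add0r -limit_avg; apply: clamp_le; [exact: limit_ge0|].
have Qtop v : T v = 1 -> Q v = 1.
  move=> Tv; rewrite /Q lfpE -/Q /reach_reward Tv eqxx /avg /clamp.
  have Q0 := lfp_ge0 reach_reward.
  have := Q0 (amax Q v); have := Q0 (amin Q v); rewrite -/Q.
  by case: ifP; [lra|case: ifP; lra].
have Qavg v : T v != 1 -> Q v = avg Q v.
  move=> Tv; rewrite {1}/Q lfpE -/Q /reach_reward (negPf Tv) add0r clamp_id //.
  have Q0 := lfp_ge0 reach_reward; have Q1 := lfp_le1 reach_reward.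
  have := Q0 (amax Q v); have := Q0 (amin Q v).
  have := Q1 (amax Q v); have := Q1 (amin Q v); rewrite -/Q /avg.
  by lra.
case: (@arg_maxP _ _ _ v0 xpredT (fun v => T v - Q v) isT) => a _ aP.
set m := T a - Q a in aP.
have mP v : T v - Q v <= m by exact: aP.
apply/eqP; rewrite eq_le QT andbT leNgt; apply/negP => Qv0.
have m0 : 0 < m by have := mP v0; lra.
pose M v := T v - Q v == m.
have Ma : M a by rewrite /M eqxx.
case: (@arg_maxP _ _ _ a M T Ma) => b Mb bP.
pose S v := M v && (T v == T b).
have Sb : S b by rewrite /S Mb eqxx.
have MT1 v : M v -> T v != 1.
  by move=> /eqP Mv; apply/eqP => Tv; move: Mv; rewrite Tv (Qtop _ Tv); lra.
have Scl u w : S u -> edge u w -> S w.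
  move=> /andP[Mu /eqP Tu] uw.
  have Eu := Qavg u (MT1 _ Mu); have ET := limit_avg u; move: (Mu) => /eqP MuE.
  have h1 := mP (amax T u); have h2 := mP (amin Q u).
  have h3 := le_amax Q (edge_amax T u); have h4 := ge_amin T (edge_amin Q u).
  (* [avg T u] and [avg Q u] differ by [m], while [T - Q] is at most [m] at [amax T u] and
     [amin Q u]; so equality holds throughout, and [Q (amax Q u) = T (amax T u) - m]. *)
  have Mmax x : edge u x -> T x = T (amax T u) -> M x.
    move=> ux Tx; have := mP x; have := le_amax Q ux; rewrite /M Tx.
    move=> ? ?; apply/eqP; move: Eu ET; rewrite /avg; lra.
  have h5 : T (amax T u) <= T b := bP _ (Mmax _ (edge_amax T u) erefl).
  (* [T u] is the largest value of [T] on [M], which contains [amax T u]; so the average at [u]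
     equals its own maximum. *)
  have all_eq : T w = T (amax T u).
    apply: avg_amaxE uw; rewrite -ET; have := ge_amin T (edge_amax T u).
    by move: ET; rewrite /avg; lra.
  rewrite /S Mmax //= all_eq -Tu; apply/eqP.
  by have := ge_amin T (edge_amax T u); move: ET; rewrite /avg; lra.
have := @limit_closed_const S (T b) b Sb _ Scl.
case/(_ _)/negP => [u /andP[_ /eqP] //|].
have := MT1 _ Mb; have := limit_le1 b; rewrite le_eqVlt => /orP[/eqP-> /eqP//|->].
move=> _; rewrite andbT; have := lfp_ge0 reach_reward b; rewrite -/Q.
by move/eqP: Mb; lra.
Qed.

End Limit.

(** * Energy bounds and the limit inferior *)

Section LimInf.
Variable R : realType.

Lemma limn_einf_le (u : (\bar R)^nat) (a : \bar R) :
  (forall N, exists2 n, (N <= n)%N & (u n <= a)%E) -> (limn_einf u <= a)%E.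
Proof.
move=> h; rewrite limn_einf_lim; apply: lime_le; first exact: is_cvg_einfs.
apply: nearW => N; have [n Nn una] := h N.
by apply: le_trans una; apply: ereal_inf_lbound; exists n.
Qed.

Lemma limn_einf_ge (u : (\bar R)^nat) (a : \bar R) N :
  (forall n, (N <= n)%N -> (a <= u n)%E) -> (a <= limn_einf u)%E.
Proof.
move=> h; rewrite limn_einf_lim; apply: lime_ge; first exact: is_cvg_einfs.
exists N => // m /= Nm; apply: le_ereal_inf_tmp => _ [n /= mn <-].
exact: h (leq_trans Nm mn).
Qed.

Lemma limn_einf_mean_le0 (E : nat -> int) (K : R) :
  (forall N, exists2 n, (N <= n)%N & (E n)%:~R <= K) ->
  (limn_einf (fun n => ((E n)%:~R / n%:R : R)%:E) <= 0)%E.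
Proof.
move=> h; apply/lee_addgt0Pr => e e0; rewrite add0e.
apply: limn_einf_le => N.
have [M KM] := eventually_le_mulrn K e0.
(* The successor excludes the junk quotient at [n = 0]. *)
have [n] := h (maxn N M.+1); rewrite geq_max => /andP[Nn Mn] EK.
exists n => //; rewrite lee_fin ler_pdivrMr; last by rewrite ltr0n; case: n Mn {Nn EK}.
exact: le_trans EK (KM n (ltnW Mn)).
Qed.

Lemma limn_einf_mean_gt0 (E : nat -> int) (c K : R) N : 0 < c ->
  (forall n, (N <= n)%N -> c * n%:R - K <= (E n)%:~R) ->
  (0 < limn_einf (fun n => ((E n)%:~R / n%:R : R)%:E))%E.
Proof.
move=> c0 h; apply: (@lt_le_trans _ _ (c / 2)%:E); first by rewrite lte_fin; lra.
have c20 : 0 < c / 2 by lra.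
have [M KM] := eventually_le_mulrn K c20.
apply: (@limn_einf_ge _ _ (maxn N M.+1)) => n.
rewrite geq_max => /andP[Nn Mn].
rewrite lee_fin ler_pdivlMr; last by rewrite ltr0n; case: n Mn {Nn}.
by apply: le_trans (h n Nn); have := KM n (ltnW Mn); lra.
Qed.

End LimInf.

(** * One round of a play *)

Section Play.
Variables (R : realType) (G : mp_game) (tie : tie_rule R G) (v : vertex G) (B : R).
Hypothesis B01 : 0 <= B <= 1.
Implicit Types (h : history R G) (f : vertex G -> R).

Lemma min_budget_bounds h : valid_history v B h -> 0 <= min_budget B h <= 1.
Proof.
elim: h => [//|h IH p b u] /= [/IH{}IH].
by case: p => /= /andP[? ?] _; lra.
Qed.

Variables smin smax : strategy R G.
Hypothesis min_legal : legal Min v B smin.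
Hypothesis max_legal : legal Max v B smax.

Local Notation hp := (play_prefix tie smin smax v).
Local Notation x n := (cur (hp n)).
Local Notation mb n := (min_budget B (hp n)).

Lemma play_prefix_valid n : valid_history v B (hp n).
Proof.
elim: n => //= n IH.
have [bmin emin] := min_legal IH; have [bmax emax] := max_legal IH.
by case: ifP => _ //=; case: ifP => _ //=; case: (tie _ _).
Qed.

Lemma play_budget n : 0 <= mb n <= 1.
Proof. exact: min_budget_bounds (play_prefix_valid n). Qed.

Lemma play_edge n : edge (x n) (x n.+1).
Proof.
have := play_prefix_valid n.+1; rewrite /=.
by case: ifP => _; [|case: ifP => _; [|case: tie]] => -[].
Qed.

Lemma play_round n : exists p b u, hp n.+1 = hround (hp n) p b u.
Proof.
rewrite /=; case: ifP => _; last case: ifP => _; last case: tie.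
all: by do 3!eexists.
Qed.

(** Under any tie rule, a lost round means that Max's bid was at least Min's, and Min receives
    it. *)
Lemma play_min_step n :
  (mb n.+1 = mb n - (smin (hp n)).1 /\ x n.+1 = (smin (hp n)).2) \/
  mb n + (smin (hp n)).1 <= mb n.+1.
Proof.
rewrite /=; case: ltP => /= [_|le]; first by left.
case: ltP => /= [_|ge]; first by right; lra.
by case: tie => /=; [left | right; lra].
Qed.

Lemma play_max_step n :
  (mb n.+1 = mb n + (smax (hp n)).1 /\ x n.+1 = (smax (hp n)).2) \/
  mb n.+1 <= mb n - (smax (hp n)).1.
Proof.
rewrite /=; case: ltP => /= [lt|_]; first by right; lra.
case: ltP => /= [_|ge]; first by left.
by case: tie => /=; [right; lra | left].
Qed.

Lemma play_min_potential f n :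
  smin (hp n) = (half_gap f (x n), amin f (x n)) ->
  f (x n.+1) - mb n.+1 <= avg f (x n) - mb n.
Proof.
move=> sE; have := play_min_step n; rewrite sE => -[[-> ->]|] /=.
  by rewrite aminE; lra.
by have := le_amax f (play_edge n); rewrite amaxE; lra.
Qed.

Lemma play_max_potential f n :
  smax (hp n) = (half_gap f (x n), amax f (x n)) ->
  mb n.+1 - f (x n.+1) <= mb n - avg f (x n).
Proof.
move=> sE; have := play_max_step n; rewrite sE => -[[-> ->]|] /=.
  by rewrite amaxE; lra.
by have := ge_amin f (play_edge n); rewrite aminE; lra.
Qed.

Lemma energyS n :
  energy (play tie smin smax v) n.+1 =
  energy (play tie smin smax v) n + weight (x n).
Proof. by rewrite /energy big_ord_recr. Qed.

End Play.

(** * Min's strategy above the limit value *)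

Section MinStrategy.
Variables (R : realType) (G : mp_game) (T : vertex G -> R).
Hypothesis T_lim : limit_value T.

(** Three quarters of the surplus cover the errors at the starting vertex and at the restart vertex
    and the last weight; the fourth leaves a positive surplus on restart. The default 0 is excluded
    by [pick_scaleP]. *)
Definition pick_scale (v0 : vertex G) (B0 : R) : nat :=
  xget 0%N (close T ((B0 - T v0) / 4)).

Lemma pick_scaleP v0 B0 : T v0 < B0 ->
  close T ((B0 - T v0) / 4) (pick_scale v0 B0).
Proof.
move=> TB; have e0 : 0 < (B0 - T v0) / 4 by lra.
by have [n h] := limit_approx T_lim e0; apply: (@xgetPex _ 0%N (close _ _)); exists n.
Qed.

(** The cap by [b] makes the bid legal on every history; it is idle on the plays satisfying the
    invariant below. *)
Definition min_plan v0 B0 : memoryless R G :=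
  let P := value R (pick_scale v0 B0) in
  Memoryless (amin P) (fun v b _ => Num.min b (half_gap P v)).

Definition min_phase : phase R G := Phase min_plan (fun _ k => k < 0).

Definition min_strategy B : strategy R G := concatenation (fun=> min_phase) B.

Lemma min_strategy_memoryless B : memoryless_strategy B (min_strategy B).
Proof.
exists (fun=> min_phase), 0%N, 2%N; split=> // _ v0 B0 v.
split; first exact: (edge_amin (value R (pick_scale v0 B0)) v).
pose g := half_gap (value R (pick_scale v0 B0)) v.
exists (fun i : 'I_2 => if i == 0 then 'X else (g%:P)%:P) => b k.
rewrite /= -/g; case: (leP b g) => _.
  by exists 0; rewrite eqxx !hornerE.
by exists 1; rewrite /= !hornerE.
Qed.

Variables (tie : tie_rule R G) (v : vertex G) (B : R).
Hypothesis B01 : 0 <= B <= 1.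

Lemma min_strategy_legal : legal Min v B (min_strategy B).
Proof.
move=> h /(min_budget_bounds B01) h01; split; last exact: edge_amin.
rewrite /= le_min half_gap_ge0 ge_min lexx /= !andbT.
by case/andP: h01.
Qed.

Hypothesis TB : T v < B.
Variable smax : strategy R G.
Hypothesis max_legal : legal Max v B smax.

Let hp := play_prefix tie (min_strategy B) smax v.
Let E n := energy (play tie (min_strategy B) smax v) n.
Let st n := run_phases (fun=> min_phase) B (hp n).
Let scale n := pick_scale (init_vertex (st n)) (init_budget (st n)).

Let st_step n : st n.+1 =
  let k := phase_energy (st n) + weight (cur (hp n)) in
  if k < 0 then PhaseState (Defs.index (st n)).+1 (cur (hp n.+1)) (min_budget B (hp n.+1)) 0
  else PhaseState (Defs.index (st n)) (init_vertex (st n)) (init_budget (st n)) k.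
Proof.
rewrite /st /hp; have [p [b [u ->]]] := play_round tie v (min_strategy B) smax n.
by [].
Qed.

(** The total energy is at most that of the current phase because every finished phase ended with
    negative energy. *)
Let inv n :=
  [/\ T (init_vertex (st n)) < init_budget (st n),
      0 <= phase_energy (st n),
      E n <= phase_energy (st n) &
      value R (scale n) (cur (hp n)) +
        (init_budget (st n) - value R (scale n) (init_vertex (st n))) +
        scale_by R (scale n) (phase_energy (st n)) <= min_budget B (hp n)].

Let inv_holds n : inv n.
Proof.
elim: n => [|n [Tib k0 Ek]].
  by rewrite /inv /E /energy big_ord0 /=; split=> //; rewrite /scale_by mul0r; lra.
have := pick_scaleP Tib; rewrite -/(scale n).
set s := st n in Tib k0 Ek *; set N := scale n; set u := cur (hp n) => cl bud.
have k0' : 0 <= scale_by R N (phase_energy s).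
  by apply: divr_ge0 => //; rewrite ler0z.
have mb01 : 0 <= min_budget B (hp n) <= 1.
  by have := play_budget tie B01 min_strategy_legal max_legal n.
have [c1 c2 c3 c4] := cl u; have [c5 c6 _ _] := cl (init_vertex s).
(* The budget is at most 1 and exceeds the value, so the cut at 1 is idle. *)
have Pu : scaled_weight R N u + avg (value R N) u <= value R N u.
  by rewrite {2}/value lfpE; apply: clamp_lt1; rewrite -lfpE -/(value R N u); lra.
have gap0 := half_gap_ge0 (value R N) u.
have Pmin0 : 0 <= value R N (amin (value R N) u) by exact: lfp_ge0.
have smE : min_strategy B (hp n) = (half_gap (value R N) u, amin (value R N) u).
  rewrite /min_strategy /concatenation -/(st n) /=; congr (_, _).
  by apply/min_idPr; rewrite -/N -/u; move: Pmin0; rewrite aminE; lra.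
have := play_min_potential min_strategy_legal max_legal smE; rewrite -/hp -/u => step.
rewrite /inv /scale st_step -/s -/u /E energyS -/hp -/u -/(E n).
move: (hp n.+1) step => h' step.
case: (ltP (phase_energy s + weight u) 0) => /= k1; last first.
  by rewrite -/N scale_byD -/(scaled_weight R N u); split=> //; [by rewrite lerD2r | lra].
(* Before the last weight the energy was nonnegative, so the rescaled deficit is at most a quarter
   of the surplus. *)
have [c7 _ _ _] := cl (cur h').
split; [lra | exact: lexx | | by rewrite /scale_by mul0r; lra].
by apply: le_trans (ltW k1); rewrite lerD2r.
Qed.

(** A restart resets the energy to 0, so without zeros the phase never changes. *)
Let init_const N : (forall n, (N <= n)%N -> phase_energy (st n) != 0) ->
  forall n, (N <= n)%N ->
    init_vertex (st n) = init_vertex (st N) /\ init_budget (st n) = init_budget (st N).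
Proof.
move=> nz; elim=> [|n IH]; first by rewrite leqn0 => /eqP ->.
rewrite leq_eqVlt => /orP[/eqP -> //|Nn].
have := nz n.+1 (leqW Nn); have [<- <-] := IH Nn; rewrite st_step /=.
by case: ifP.
Qed.

Lemma min_strategy_mean_payoff :
  (mean_payoff R (play tie (min_strategy B) smax v) <= 0)%E.
Proof.
have [inf|] := pselect (forall N, exists2 n, (N <= n)%N & phase_energy (st n) = 0).
  apply: (@limn_einf_mean_le0 _ _ 0) => N; have [n Nn kn] := inf N.
  by exists n => //; have [_ _] := inv_holds n; rewrite kn lerz0.
move/existsNP => [N fin].
have {}fin n : (N <= n)%N -> phase_energy (st n) != 0.
  by move=> Nn; apply/eqP => kn; apply: fin; exists n.
(* In the final phase the budget, at most 1, bounds the rescaled energy by 1. *)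
apply: (@limn_einf_mean_le0 _ _ (scale N).+1%:R) => M.
exists (maxn M N); first exact: leq_maxl.
set n := maxn M N; have [eqv eqB] := init_const fin (leq_maxr M N : (N <= n)%N).
have [Tib k0 Ek bud] := inv_holds n.
have scE : scale n = scale N by rewrite /scale eqv eqB.
have [_ c2 _ _] := pick_scaleP Tib (init_vertex (st n)).
have /andP[_ mb1] := play_budget tie B01 min_strategy_legal max_legal n.
have P0 : 0 <= value R (scale n) (cur (hp n)) by exact: lfp_ge0.
apply: (@le_trans _ _ (phase_energy (st n))%:~R); first by rewrite ler_int.
rewrite -scE -[leRHS]mul1r -ler_pdivrMr ?ltr0n // -/(scale_by R (scale n) _).
by move: mb1 bud c2; rewrite -/hp /scale; lra.
Qed.

End MinStrategy.

Lemma min_strategy_guarantees (R : realType) (G : mp_game) (T : vertex G -> R)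
    (T_lim : limit_value T) (tie : tie_rule R G) (v : vertex G) (B : R) :
  0 <= B <= 1 -> T v < B -> min_guarantees tie v B (min_strategy T B).
Proof.
move=> B01 TB; split; first exact: min_strategy_legal.
by move=> smax lmax; exact: min_strategy_mean_payoff.
Qed.

(** Invert [1 + z <= expR z] at [z = 2x^2 - x]; then [(1 + x)(1 + z) = 1 + x^2 (1 + 2x)] is at least
    1. *)
Lemma expR_quadratic_le (R : realType) (x : R) : - (1 / 2) <= x -> expR (x - 2 * x ^+ 2) <= 1 + x.
Proof.
move=> x2; rewrite -[_ - _]opprB expRN.
have p0 : 0 < 1 + (2 * x ^+ 2 - x) by nra.
apply: (@le_trans _ _ (1 + (2 * x ^+ 2 - x))^-1).
  by rewrite lef_pV2 ?posrE ?expR_gt0 // expR_ge1Dx.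
by rewrite -[X in X <= _]mul1r ler_pdivrMr //; nra.
Qed.

(** * Max's strategy below the limit value *)

Section MaxStrategy.
Variables (R : realType) (G : mp_game) (T : vertex G -> R).
Hypothesis T_lim : limit_value T.

(* [Y] leads the token to the vertices where [T = 1]; there, bids proportional
   to Max's budget let the energy grow. *)
Definition max_strategy (Y phi : vertex G -> R) (delta B : R) : strategy R G :=
  fun h => let u := cur h in let C := 1 - min_budget B h in
    if T u == 1 then (C * (delta * half_gap phi u), amax phi u)
    else (Num.min C (half_gap Y u), amax Y u).

Variables (tie : tie_rule R G) (v : vertex G) (B : R).
Hypothesis B01 : 0 <= B <= 1.
Variables (d delta : R) (n0 : nat).
Let Y := lfp (fun u => reach_reward T u - d).
Let phi := lfp (fun u : vertex G => scaled_weight R n0 u - delta).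
Hypothesis d01 : 0 < d <= 1.
Hypothesis delta01 : 0 < delta <= 1.
Hypothesis YB : B < Y v.
Hypothesis phi_gt0 : forall u, T u = 1 -> 0 < phi u.

Local Notation sigma := (max_strategy Y phi delta B).

Let Y01 u : 0 <= Y u <= 1. Proof. exact: lfp01. Qed.

Let phi01 u : 0 <= phi u <= 1. Proof. exact: lfp01. Qed.

Let bet u := delta * half_gap phi u.

Let bet_bounds u : 0 <= bet u <= 1 / 2.
Proof.
case/andP: delta01 => delta0 delta1; have g0 := half_gap_ge0 phi u.
apply/andP; split; first by apply: mulr_ge0 => //; exact: ltW.
by apply: le_trans (half_gap_le_half u phi01); apply: ler_piMl.
Qed.

Let bet_square u : 2 * bet u ^+ 2 <= delta ^+ 2 / 2.
Proof.
rewrite /bet exprMn; have g0 := half_gap_ge0 phi u.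
have g2 := half_gap_le_half u phi01.
have gg : 0 <= 1 / 4 - half_gap phi u ^+ 2 by nra.
by have := mulr_ge0 (sqr_ge0 delta) gg; lra.
Qed.

Lemma max_strategy_legal : legal Max v B sigma.
Proof.
move=> h /(min_budget_bounds B01) h01; rewrite /max_strategy /budget.
case: ifP => _ /=; split; try exact: edge_amax.
  by rewrite -/(bet _); have := bet_bounds (cur h); nra.
by rewrite le_min half_gap_ge0 ge_min lexx /= !andbT; lra.
Qed.

Variable smin : strategy R G.
Hypothesis min_legal : legal Min v B smin.

Local Notation hp := (play_prefix tie smin sigma v).
Local Notation x n := (cur (hp n)).
Local Notation mb n := (min_budget B (hp n)).
Local Notation E n := (energy (play tie smin sigma v) n).

Let mb01 n : 0 <= mb n <= 1.
Proof. by have := play_budget tie B01 min_legal max_strategy_legal n. Qed.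

(** Max's excess [Y (x n) - mb n] gains [d] per round: a positive excess forces [Y (x n) > 0], so
    the cut at 0 is idle and [Y] lies [d] below its average. *)
Let approach n : (forall i, (i < n)%N -> T (x i) != 1) ->
  mb n <= Y (x n) - (Y v - B) - d * n%:R.
Proof.
elim: n => [_|n IH Tn]; first by rewrite mulr0 /=; lra.
have {}IH : mb n <= Y (x n) - (Y v - B) - d * n%:R.
  by apply: IH => i ni; apply: Tn; exact: ltnW.
have gap_pos : 0 < Y v - B by rewrite subr_gt0.
have Tx := Tn n (ltnSn n); have /andP[mb0 mb1] := mb01 n.
rewrite -natr1 mulrDr mulr1.
have : 0 <= d * n%:R by rewrite mulr_ge0 ?ler0n // ltW //; case/andP: d01.
have /andP[d_pos _] := d01; move: (d * n%:R) IH => q IH q0.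
have Yavg : Y (x n) <= avg Y (x n) - d.
  have := @clamp_gt0 R (reach_reward T (x n) - d + avg Y (x n)).
  rewrite -[clamp _](lfpE (fun u => reach_reward T u - d)) -/(Y (x n)).
  rewrite /reach_reward (negPf Tx) => h; have Yx : 0 < Y (x n) by lra.
  by have := h Yx; lra.
have sE : sigma (hp n) = (half_gap Y (x n), amax Y (x n)).
  rewrite /max_strategy -/(x n) -/(mb n) (negPf Tx); congr (_, _).
  by apply/min_idPr; have := Y01 (amax Y (x n)); rewrite amaxE; lra.
have := play_max_potential min_legal max_strategy_legal sE.
rewrite -/hp -/(x n) -/(x n.+1) -/(mb n) -/(mb n.+1); lra.
Qed.

Let reaches_top : exists n, T (x n) = 1 /\ mb n < 1.
Proof.
have gap_pos : 0 < Y v - B by rewrite subr_gt0.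
have [n Tn] : exists n, T (x n) == 1.
  apply/not_existsP => H.
  have [N dN] := eventually_le_mulrn 1 (proj1 (andP d01)).
  have := approach (n := N) (fun i _ => introN idP (H i)).
  move: (d * N%:R) (dN N (leqnn N)) => q.
  by have := mb01 N; have := Y01 (x N); lra.
have exT : exists n, T (x n) == 1 by exists n.
case: (ex_minnP exT) => m /eqP Tm mmin; exists m; split=> //.
have Tlt i : (i < m)%N -> T (x i) != 1.
  by move=> im; apply/negP => /mmin; rewrite leqNgt im.
have dm : 0 <= d * m%:R by rewrite mulr_ge0 ?ler0n // ltW //; case/andP: d01.
by move: (d * m%:R) dm (approach Tlt) (Y01 (x m)) => q; lra.
Qed.

(** Up to a constant, a lower bound for the logarithm of Max's budget. As that budget is at most 1,
    the rescaled energy must grow with slope [delta / 2]. *)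
Let potential n := delta * (delta / 2 * n%:R - scale_by R n0 (E n) - phi (x n)).

(** Max's budget is multiplied by at least [1 - bet] on a win and [1 + bet] on a loss. Half of the
    drift [delta] of [phi] pays for the quadratic loss in [expR_quadratic_le], the other half is the
    slope in [potential]. *)
Let top_step n : T (x n) = 1 -> mb n < 1 ->
  T (x n.+1) = 1 /\
  (1 - mb n) * expR (potential n.+1 - potential n) <= 1 - mb n.+1.
Proof.
move=> Tx mb1.
have xS : edge (x n) (x n.+1) := play_edge tie min_legal max_strategy_legal n.
split; first exact (limit_top_closed T_lim Tx xS).
have phi_avg : phi (x n) <= scaled_weight R n0 (x n) - delta + avg phi (x n).
  have := phi_gt0 Tx; rewrite /phi lfpE -/phi; exact: clamp_gt0.
have potS : potential n.+1 - potential n =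
    delta * (delta / 2 - scaled_weight R n0 (x n) - (phi (x n.+1) - phi (x n))).
  rewrite /potential energyS scale_byD -/hp -/(x n) -/(E n).
  by rewrite -/(scaled_weight R n0 (x n)) -[n.+1]addn1 natrD; ring.
have sE : sigma (hp n) = ((1 - mb n) * bet (x n), amax phi (x n)).
  by rewrite /max_strategy -/(x n) -/(mb n) Tx eqxx.
have /andP[delta0 delta1] := delta01.
have b0 := bet_bounds (x n); have b2 := bet_square (x n).
have C0 : 0 <= 1 - mb n by lra.
have grow (t : R) : - (1 / 2) <= t -> 2 * t ^+ 2 <= delta ^+ 2 / 2 ->
    potential n.+1 - potential n <= t - delta ^+ 2 / 2 ->
    (1 - mb n) * expR (potential n.+1 - potential n) <= (1 - mb n) * (1 + t).
  move=> t2 tt pt; apply: ler_wpM2l => //; apply: le_trans (expR_quadratic_le t2).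
  by rewrite ler_expR; lra.
have gapE : delta * half_gap phi (x n) = bet (x n) by [].
have := play_max_step tie v B smin sigma n.
rewrite -/hp -/(x n.+1) -/(mb n) -/(mb n.+1) sE /= => -[[-> xE]|mbS].
  apply: le_trans (grow (- bet (x n)) _ _ _) _; [lra | by rewrite sqrrN | | lra].
  have := amaxE phi (x n); rewrite -xE potS => phiE.
  by move: (phi (x n.+1)) phiE => p ->; nra.
apply: le_trans (grow (bet (x n)) _ _ _) _; [lra | by [] | | lra].
have := ge_amin phi xS; rewrite aminE potS => phiE.
by nra.
Qed.

Lemma max_strategy_mean_payoff : (0 < mean_payoff R (play tie smin sigma v))%E.
Proof.
have [m [Tm mbm]] := reaches_top.
(* Chosen so that the exponential bound is an equality at the first visit. *)
pose kappa := (1 - mb m) * expR (- potential m).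
have kappa0 : 0 < kappa by rewrite mulr_gt0 ?expR_gt0 //; lra.
have top n : (m <= n)%N -> T (x n) = 1 /\ kappa * expR (potential n) <= 1 - mb n.
  elim: n => [|n IH]; rewrite leq_eqVlt => /orP[/eqP <-|mn] //.
  - by split=> //; rewrite /kappa -mulrA -expRD addNr expR0 mulr1.
  - by split=> //; rewrite /kappa -mulrA -expRD addNr expR0 mulr1.
  have [Tx kx] := IH mn.
  have kp : 0 < kappa * expR (potential n) by rewrite mulr_gt0 ?expR_gt0.
  have [|TS CS] := top_step Tx; first by lra.
  split=> //; apply: le_trans CS.
  have -> : expR (potential n.+1) = expR (potential n) * expR (potential n.+1 - potential n).
    by rewrite -expRD addrC subrK.
  by rewrite mulrA; apply: ler_wpM2r => //; exact: expR_ge0.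
apply: (@limn_einf_mean_gt0 _ _ (n0.+1%:R * (delta / 2))
  (n0.+1%:R * (kappa^-1 / delta + 1)) m).
  by rewrite mulr_gt0 ?ltr0n // divr_gt0 //; case/andP: delta01.
move=> n mn; have [_ kn] := top n mn.
have /andP[_ phi1] := phi01 (x n); have /andP[delta0 delta1] := delta01.
have pot : potential n <= kappa^-1.
  have := expR_ge1Dx (potential n); have := mb01 n => mbn.
  have : expR (potential n) <= kappa^-1.
    by rewrite -[leRHS]mul1r ler_pdivlMr // mulrC; lra.
  by lra.
have {}pot : delta / 2 * n%:R - scale_by R n0 (E n) - phi (x n) <= kappa^-1 / delta.
  by rewrite ler_pdivlMr 1?mulrC.
have -> : (E n)%:~R = n0.+1%:R * scale_by R n0 (E n).
  by rewrite /scale_by mulrC divfK // pnatr_eq0.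
by rewrite -mulrA -mulrBr; apply: ler_wpM2l => //; lra.
Qed.

End MaxStrategy.

Lemma max_guarantees_below_limit (R : realType) (G : mp_game) (T : vertex G -> R)
    (T_lim : limit_value T) (tie : tie_rule R G) (v : vertex G) (B : R) :
  0 <= B <= 1 -> B < T v -> exists smax, max_guarantees tie v B smax.
Proof.
move=> B01 BT.
have e0 : 0 < (T v - B) / 2 by lra.
have [d d01 Yd] := lfp_lower_continuous (reach_reward T) e0.
(* Where [T = 1], two errors of a quarter leave [phi] at least one half. *)
have q0 : 0 < 1 / 4 :> R by lra.
have [n0 close_n0] := limit_approx T_lim q0.
have [delta delta01 phid] := lfp_lower_continuous (scaled_weight R (G := G) n0) q0.
pose Y := lfp (fun u => reach_reward T u - d).
pose phi := lfp (fun u : vertex G => scaled_weight R n0 u - delta).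
have YB : B < Y v by have := Yd v; rewrite -(limit_reach T_lim) -/(Y v); lra.
have phi_gt0 u : T u = 1 -> 0 < phi u.
  move=> Tu; have [h _ _ _] := close_n0 u.
  by have := phid u; rewrite -/(phi u) -/(value R n0 u); lra.
exists (max_strategy T Y phi delta B).
split; first exact: max_strategy_legal.
by move=> smin lmin; exact: max_strategy_mean_payoff.
Qed.

Theorem theorem23 (R : realType) (G : mp_game) (tie : tie_rule R G)
    (Thresh : vertex G -> R) (hThresh : is_threshold tie Thresh)
    (v : vertex G) (B : R) (hB : 0 <= B <= 1) (hvB : Thresh v < B) :
  exists smin : strategy R G,
    memoryless_strategy B smin /\ min_guarantees tie v B smin.
Proof.
have [T T_lim] := limit_value_exists R G.
exists (min_strategy T B); split; first exact: min_strategy_memoryless.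
apply: min_strategy_guarantees => //; apply: le_lt_trans hvB.
rewrite leNgt; apply/negP => lt.
have [/andP[T0 _] win _] := hThresh v; have T1 := limit_le1 T_lim v.
(* At a budget strictly between, both players would have winning strategies, which contradict each
   other when played together. *)
pose B' := (Thresh v + T v) / 2.
have B'01 : 0 <= B' <= 1 by rewrite /B'; lra.
have [|smin [lmin wmin]] := win B' B'01; first by rewrite /B'; lra.
have [|smax [lmax wmax]] := @max_guarantees_below_limit _ _ _ T_lim tie v B' B'01.
  by rewrite /B'; lra.
by have := lt_le_trans (wmax _ lmin) (wmin _ lmax); rewrite ltxx.
Qed.
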